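(* Let $1\le p<n$, let $C$ be an $n$-copula, $\phi_1,\dots,\phi_p\in\mathcal{F}_1$ and $\phi_{p+1},\dots,\phi_n\in\mathcal{F}_2$, and let $\mathbf{f}=(f_1,\dots,f_n)$ be the corresponding reflected generating functions (all defined in the context). Then the reflected maxmin $n$-copula $T^\sigma_{\mathbf f}(C^\sigma)$ with $p$ maxima and $n-p$ minima, corresponding to generating functions $\mathbf f$ and reflected copula $C^\sigma$, is of the form $$T^\sigma_{\mathbf f}(C^\sigma)(\mathbf u)=\frac{C^\sigma(\widehat f_1(u_1),\dots,\widehat f_n(u_n))}{\widehat f_1(u_1)\cdots\widehat f_n(u_n)}\cdot\max\left\{0,\ \min_{\substack{j\in\{1,\dots,p\}\\ k\in\{p+1,\dots,n\}}}\left(\bigl(u_ju_k-f_j(u_j)f_k(u_k)\bigr)\prod_{\substack{i\in\{1,\dots,n\}\\ i\ne j,k}}\widehat f_i(u_i)\right)\right\}$$ for $\mathbf u=(u_1,\dots,u_n)\in[0,1]^n$.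
   Context: $\mathcal{F}_1$ is the class of nondecreasing $\phi:[0,1]\to[0,1]$ with $\phi(0)=0,\phi(1)=1$ such that $\phi^*(u):=u/\phi(u)$ is nondecreasing on $(0,1]$. $\mathcal{F}_2$ is the class of nondecreasing $\psi:[0,1]\to[0,1]$ with $\psi(0)=0,\psi(1)=1$ such that $\psi_*$, given by $\psi_*(v)=\frac{v-\psi(v)}{1-\psi(v)}$ for $v\in[0,1)$ and $\psi_*(1)=1$, is nondecreasing. For $i\le p$ write $\phi_i^*(u)=u/\phi_i(u)$; for $i>p$ write $\phi_i^*:=(\phi_i)_*$. Maxmin $n$-copula with $p$ maxima and $n-p$ minima: with $S=\{p+1,\dots,n\}$, $$T_{\Phi}(C)(\mathbf u)=\sum_{K\subseteq S}C\bigl(\Phi(\mathbf u)_{\{1,\dots,p\}\cup K^c}\bigr)\max\Bigl\{0,\ \min_{i\in\{1,\dots,p\}\cup K}\phi_i^*(u_i)-\max_{k\in K^c}\phi_k^*(u_k)\Bigr\},$$ where $K^c=S\setminus K$, $\Phi(\mathbf u)_{\{1,\dots,p\}\cup K^c}$ is the vector with $i$-th entry $\phi_i(u_i)$ for $i\in\{1,\dots,p\}\cup K^c$ and $i$-th entry $1$ for $i\in K$, and the maximum over the empty set is $0$. (Terms with some $u_i=0$, $i\le p$, are $0$.) Flip in the $i$-th variable: a function $D$ on $[0,1]^n$ is replaced by $D(\dots,1,\dots)-D(\dots,1-u_i,\dots)$ (the displayed entries being in position $i$). For an $n$-copula $C$, $C^\sigma$ denotes $C$ transformed by a flip in each of the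 variables with indices $p+1,\dots,n$. The reflected maxmin $n$-copula $T^\sigma_{\mathbf f}(C^\sigma)$ is the function obtained from $T_\Phi(C)$ by a flip in each of the variables with indices $p+1,\dots,n$. Reflected generators: $f_i(u)=\phi_i(u)-u$ for $i\le p$, $f_i(u)=1-u-\phi_i(1-u)$ for $i>p$, and $\widehat f_i(u)=u+f_i(u)$ for all $i$. The right-hand side of the claimed formula is read as $0$ when some $u_i=0$. *)

(* Defs.v *)
From HB Require Import structures.
From mathcomp Require Import all_boot all_order all_algebra.
From mathcomp Require Import reals.

Set Implicit Arguments.
Unset Strict Implicit.
Unset Printing Implicit Defensive.

Import Order.TTheory GRing.Theory Num.Theory.
Local Open Scope ring_scope.

Section FiniteExtrema.
Variables (R : realType) (I : finType).

(* The junk value 0 of [finmax] on an empty family is the convention used in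
   [maxmin]; [finmin] is only used on nonempty families. *)
Definition finmin (P : pred I) (F : I -> R) : R :=
  if [pick i | P i] is Some i0 then \big[Num.min/F i0]_(i | P i) F i else 0.

Definition finmax (P : pred I) (F : I -> R) : R :=
  if [pick i | P i] is Some i0 then \big[Num.max/F i0]_(i | P i) F i else 0.

End FiniteExtrema.

Section Copulas.
Variables (R : realType) (n : nat).
Implicit Types (C D : 'rV[R]_n -> R) (u a b : 'rV[R]_n).

Definition in_cube u : Prop := forall i, u 0 i \in `[0, 1].

(* A function on [0,1]^n is represented by a function on R^n of which only the
   values on the cube matter. *)
Record copula C : Prop := Copula {
  copula_range : forall u, in_cube u -> C u \in `[0, 1];
  copula_grounded : forall u, in_cube u ->
    (exists i, u 0 i = 0) -> C u = 0;
  copula_margins : forall u i, in_cube u ->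
    (forall j, j != i -> u 0 j = 1) -> C u = u 0 i;
  copula_increasing : forall a b, in_cube a -> in_cube b ->
    (forall i, a 0 i <= b 0 i) ->
    0 <= \sum_(K : {set 'I_n})
           (-1) ^+ #|K| * C (\row_i (if i \in K then a 0 i else b 0 i))
}.

Definition set_coord u (i : 'I_n) (x : R) : 'rV[R]_n :=
  \row_j (if j == i then x else u 0 j).

Definition flip (i : 'I_n) D : 'rV[R]_n -> R :=
  fun u => D (set_coord u i 1) - D (set_coord u i (1 - u 0 i)).

(* Indices are 0-based: the maxima are the [i < p], the minima the [p <= i]. *)
Definition min_vars (p : nat) : {set 'I_n} := [set i : 'I_n | (p <= i)%N].

Definition reflection (p : nat) D : 'rV[R]_n -> R :=
  foldr flip D (enum (min_vars p)).

End Copulas.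

Section Generators.
Variable R : realType.
Implicit Types phi psi : R -> R.

Definition unit_nondecreasing phi : Prop :=
  [/\ {in `[0, 1], forall u, phi u \in `[0, 1]},
      {in `[0, 1] &, {homo phi : x y / x <= y}},
      phi 0 = 0
    & phi 1 = 1].

Definition upper_star phi (u : R) : R := u / phi u.

Definition lower_star psi (v : R) : R :=
  if v == 1 then 1 else (v - psi v) / (1 - psi v).

(* Since x / 0 = 0, the quotients defining the two starred functions have to be
   required explicitly to be meaningful. *)
Definition F1 phi : Prop :=
  [/\ unit_nondecreasing phi,
      {in `]0, 1], forall u, phi u != 0}
    & {in `]0, 1] &, {homo upper_star phi : x y / x <= y}}].

Definition F2 psi : Prop :=
  [/\ unit_nondecreasing psi,
      {in `[0, 1[, forall v, psi v != 1}
    & {in `[0, 1] &, {homo lower_star psi : x y / x <= y}}].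

End Generators.

Section Maxmin.
Variables (R : realType) (n p : nat).
Variable phi : 'I_n -> R -> R.
Implicit Types (C : 'rV[R]_n -> R) (u : 'rV[R]_n).

Definition gen_star (i : 'I_n) : R -> R :=
  if (i < p)%N then upper_star (phi i) else lower_star (phi i).

Definition maxmin C u : R :=
  let S := min_vars n p in
  if [exists i : 'I_n, (i < p)%N && (u 0 i == 0)] then 0 else
  \sum_(K : {set 'I_n} | K \subset S)
    C (\row_i (if i \in K then 1 else phi i (u 0 i))) *
    Num.max 0 (finmin (fun i => i \in ~: S :|: K) (fun i => gen_star i (u 0 i))
             - finmax (fun k => k \in S :\: K) (fun k => gen_star k (u 0 k))).

Definition reflected_maxmin C : 'rV[R]_n -> R := reflection p (maxmin C).

Definition refl_gen (i : 'I_n) (u : R) : R :=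
  if (i < p)%N then phi i u - u else 1 - u - phi i (1 - u).

Definition refl_gen_hat (i : 'I_n) (u : R) : R := u + refl_gen i u.

End Maxmin.

(* Main.v *)
Require Import Defs.
From HB Require Import structures.
From mathcomp Require Import all_boot all_order all_algebra.
From mathcomp Require Import reals ring lra.

Set Implicit Arguments.
Unset Strict Implicit.
Unset Printing Implicit Defensive.

Import Order.TTheory GRing.Theory Num.Theory.
Local Open Scope ring_scope.

(** Write [S] for the set of minima, [b k] for the starred generator of a
    minimum [k] at [1 - u k], and [A] for the least of the starred generators
    of the maxima at [u].

    A reflection is an alternating sum over the vertices [L \subset S] of a
    box: the coordinates in [L] are set to [1 - u i], the other coordinates in
    [S] to [1] ([foldr_flipE]).  Generators and starred generators of the
    minima are [1] at [1], and [A <= 1], so in the sum over [M = S :\: K]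
    defining the maxmin copula at the vertex [L] only the sets [M \subset L]
    contribute, and the value of [C] in such a term depends on [M] alone
    ([maxmin_vertex]).  Exchanging the two sums ([exchange_subsets]) leaves,
    next to the value of [C], the sum
      [\sum_(N \subset S :\: M)
         (-1) ^+ #|N| * max 0 (min (A, b on N) - max (b on M))],
    which is an inclusion-exclusion: the summand is the length of the part of
    the interval from [max (b on M)] to [A] lying below all [b i], [i \in N],
    so the sum is the length of the part lying above all the [b i] outside [M],
    that is [max 0 (A - max (b on S))] ([sum_alternating_hinge]).  This
    no longer depends on [M], and the remaining alternating sum over [M] of the
    values of [C] is the reflection of [C] at the reflected generators, since
    [1 - fhat_k u_k = phi_k (1 - u_k)].

    The product in the claimed formula is the same length in other terms: with
    [a j = u_j / fhat_j] and [b k = 1 - u_k / fhat_k], one has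
    [u_j u_k - f_j f_k = (a j - b k) * fhat_j * fhat_k], and the minimum of
    [a j - b k] over all pairs is [min a - max b] ([finmin_pair]).

    If some [u i] is [0], the left-hand side vanishes for a simpler reason:
    every vertex has that coordinate [0] when [i] is a maximum, and the flip in
    the variable [i] is a difference of equal values when [i] is a minimum. *)

(** * Sums over subsets *)

Section SubsetSums.
Variables (V : nmodType) (T : finType).
Implicit Types (A S L M N : {set T}).

(** The subsets of [i |: A] come in pairs [L], [i |: L]: the step of an induction
    on the ambient set. *)
Lemma big_subset_setU1 i A (F : {set T} -> V) : i \notin A ->
  \sum_(L : {set T} | L \subset i |: A) F L =
  \sum_(L : {set T} | L \subset A) (F L + F (i |: L)).
Proof.
move=> iA; rewrite big_split /= (bigID (fun L : {set T} => i \in L)) /= addrC.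
congr (_ + _).
  apply: eq_bigl => L; apply/andP/idP => [[/subsetP LA iL]|/subsetP LA].
    apply/subsetP => x xL; have /setU1P[xi|//] := LA x xL.
    by rewrite -xi xL in iL.
  split; last by apply: contra iA => /LA.
  by apply/subsetP => x /LA xA; rewrite !inE xA orbT.
rewrite (reindex_onto (fun L => i |: L) (fun L => L :\ i)) /=; last first.
  by move=> L /andP[_ iL]; rewrite setD1K.
apply: eq_bigl => L; rewrite setU11 andbT.
apply/andP/idP => [[/subsetP LA /eqP LE]|LA].
  apply/subsetP => x xL; have iL : i \notin L by rewrite -LE !inE eqxx.
  have /setU1P[xi|//] := LA x (setU1r _ xL).
  by rewrite -xi xL in iL.
split; first exact: setUS.
by rewrite setU1K //; apply: contra iA; apply: (subsetP LA).
Qed.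

(** A pair [M \subset L] of subsets is a pair of disjoint subsets [M] and
    [N = L :\: M]. *)
Lemma exchange_subsets S (G : {set T} -> {set T} -> V) :
  \sum_(L : {set T} | L \subset S) \sum_(M : {set T} | M \subset L) G L M =
  \sum_(M : {set T} | M \subset S)
    \sum_(N : {set T} | N \subset S :\: M) G (M :|: N) M.
Proof.
rewrite (exchange_big_dep (fun M : {set T} => M \subset S)) /=; last first.
  by move=> L M LS ML; apply: subset_trans ML LS.
apply: eq_bigr => M MS.
rewrite (reindex_onto (fun N => M :|: N) (fun L => L :\: M)) /=; last first.
  by move=> L /andP[_ ML]; rewrite -{2}(setID L M) (setIidPr ML).
apply: eq_bigl => N; rewrite subUset MS subsetUl andbT /=.
rewrite setDUl setDv set0U subsetD.
by congr (_ && _); apply/eqP/idP => /setDidPl.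
Qed.

End SubsetSums.

(** * Extrema of finite families *)

Section Extrema.
Variables (R : realType) (I : finType).
Implicit Types (P Q : pred I) (F G a b : I -> R).

Lemma finmin_geP P F i0 x : P i0 ->
  reflect (forall i, P i -> x <= F i) (x <= finmin P F).
Proof.
move=> Pi0; rewrite /finmin; case: pickP => [i1 Pi1|/(_ i0)]; last by rewrite Pi0.
apply: (iffP (bigmin_geP _ _ _ _)) => [[] //|xF]; split=> //; exact: xF.
Qed.

Lemma finmax_leP P F i0 x : P i0 ->
  reflect (forall i, P i -> F i <= x) (finmax P F <= x).
Proof.
move=> Pi0; rewrite /finmax; case: pickP => [i1 Pi1|/(_ i0)]; last by rewrite Pi0.
apply: (iffP (bigmax_leP _ _ _ _)) => [[] //|xF]; split=> //; exact: xF.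
Qed.

Lemma eq_finmin P Q F G : P =1 Q -> (forall i, P i -> F i = G i) ->
  finmin P F = finmin Q G.
Proof.
move=> PQ FG; rewrite /finmin -(eq_pick PQ); case: pickP => // i0 Pi0.
by rewrite FG //; apply: eq_big => // i Pi; rewrite FG.
Qed.

(** The value [0] of an empty maximum is harmless among nonnegative numbers, so
    that empty and nonempty families need not be told apart. *)
Lemma finmax_ge0E P F : (forall i, P i -> 0 <= F i) ->
  finmax P F = \big[Num.max/0]_(i | P i) F i.
Proof.
move=> F0; rewrite /finmax; case: pickP => [i0 Pi0|P0]; last by rewrite big_pred0.
apply/eqP/eq_leP => x; apply/bigmax_leP/bigmax_leP => -[xF0 xF]; split => //.
  exact: le_trans (F0 _ Pi0) xF0.
exact: xF.
Qed.

End Extrema.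

(** The minimum of [a j - b k] over a product of index sets is attained at the
    minimum of [a] and the maximum of [b]. *)
Lemma finmin_pair (R : realType) (I J : finType) (P : pred I) (Q : pred J)
    (a : I -> R) (b : J -> R) (c : R) i0 k0 : P i0 -> Q k0 -> 0 < c ->
  finmin (fun jk : I * J => P jk.1 && Q jk.2) (fun jk => (a jk.1 - b jk.2) * c) =
  (finmin P a - finmax Q b) * c.
Proof.
move=> Pi0 Qk0 c0; apply/eqP; rewrite eq_sym.
(* Both sides are characterised by their lower bounds, while [eq_leP] compares
   upper bounds: hence the passage to opposites. *)
suff /eq_leP : forall y, (- ((finmin P a - finmax Q b) * c) <= y) =
  (- finmin (fun jk : I * J => P jk.1 && Q jk.2)
     (fun jk => (a jk.1 - b jk.2) * c) <= y) by rewrite eqr_opp.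
move=> y; rewrite lerNl [RHS]lerNl; move: (- y) => x {y}.
rewrite -ler_pdivrMr // lerBrDr -lerBrDl.
apply/(finmax_leP _ _ Qk0)/(@finmin_geP _ _ _ _ (i0, k0)) => /=.
- by rewrite Pi0.
- move=> H [j k] /andP[/= Pj Qk]; rewrite -ler_pdivrMr //.
  have := H k Qk; rewrite lerBrDl => H1; have := elimT (finmin_geP _ _ Pi0) H1 j Pj.
  lra.
move=> H k Qk; rewrite lerBrDl; apply/(finmin_geP _ _ Pi0) => j Pj.
have := H (j, k); rewrite /= Pj Qk => /(_ isT); rewrite -ler_pdivrMr //; lra.
Qed.

(** Inclusion-exclusion for the subintervals of the interval from [B] to [A]
    cut off by the points [b i]: the summand is the length of the part below
    all the [b i] with [i \in N], the sum that of the part above every [b i]. *)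
Lemma sum_alternating_hinge (R : realDomainType) (I : finType) (T : {set I})
    (b : I -> R) (A B : R) :
  \sum_(N : {set I} | N \subset T)
    (-1) ^+ #|N| * Num.max 0 (\big[Num.min/A]_(i in N) b i - B) =
  Num.max 0 (A - \big[Num.max/B]_(i in T) b i).
Proof.
elim: {T}#|T| {-2}T (erefl #|T|) A B => [|m IH] T.
  move/eqP; rewrite cards_eq0 => /eqP -> A B.
  rewrite (big_pred1 set0) => [|N]; last by rewrite subset0.
  by rewrite cards0 expr0 mul1r !big_set0.
move=> cT A B; have /card_gt0P[i iT] : (0 < #|T|)%N by rewrite cT.
pose U := T :\ i; have iU : i \notin U by rewrite !inE eqxx.
have cU : #|U| = m by apply: succn_inj; rewrite -cT (cardsD1 i T) iT.
rewrite -(setD1K iT) -/U big_subset_setU1 //.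
under eq_bigr => N NU.
  have iN : i \notin N by apply: contra iU; apply: (subsetP NU).
  (* Adding [i] to [N] amounts to truncating the interval at [b i]. *)
  have -> : \big[Num.min/A]_(j in i |: N) b j =
            \big[Num.min/Num.min A (b i)]_(j in N) b j.
    apply/eqP; rewrite eq_sym -eqr_opp; apply/eq_leP => y.
    rewrite lerNl [RHS]lerNl.
    apply/bigmin_geP/bigmin_geP; rewrite le_min.
      move=> [/andP[yA yb] H]; split=> // j /setU1P[-> //|]; exact: H.
    move=> [yA H]; rewrite yA H ?setU11 //; split=> // j jN.
    by apply: H; rewrite setU1r.
  rewrite cardsU1 iN exprS mulN1r mulNr.
  over.
rewrite /= big_split /= sumrN !IH //.
have -> : \big[Num.max/B]_(j in i |: U) b j =
          Num.max (b i) (\big[Num.max/B]_(j in U) b j).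
  apply/eqP/eq_leP => y; rewrite ge_max.
  apply/bigmax_leP/andP => [[yB H]|[yb /bigmax_leP[yB H]]]; split=> //.
  - by rewrite H ?setU11.
  - by apply/bigmax_leP; split=> // j jU; rewrite H ?setU1r.
  - by move=> j /setU1P[-> //|]; apply: H.
move: (\big[_/_]_(_ in U) _) => B'.
rewrite /Num.max /Num.min; case: (ltP A (b i)) => ?; case: (ltP (b i) B') => ?.
all: by do ![case: ltP => ?]; lra.
Qed.

(** * Reflections as alternating sums *)

Section Reflection.
Variables (R : realType) (n : nat).
Implicit Types (D : 'rV[R]_n -> R) (u : 'rV[R]_n) (s : seq 'I_n).

Definition flip_vertex (S L : {set 'I_n}) u : 'rV[R]_n :=
  \row_i (if i \in L then 1 - u 0 i else if i \in S then 1 else u 0 i).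

Lemma foldr_flipE s D u : uniq s ->
  foldr (@flip R n) D s u =
  \sum_(L : {set 'I_n} | L \subset [set:: s])
    (-1) ^+ #|L| * D (flip_vertex [set:: s] L u).
Proof.
elim: s u => [|i s IH] u /=.
  move=> _; rewrite (big_pred1 set0) => [|N]; last by rewrite set_nil subset0.
  rewrite cards0 expr0 mul1r; congr D; apply/rowP => j.
  by rewrite !mxE !inE.
move=> /andP[iNs us].
have iS : i \notin [set:: s] by rewrite inE.
rewrite /flip !IH // set_cons big_subset_setU1 // -sumrB; apply: eq_bigr => L LS.
have iL : i \notin L by apply: contra iS; apply: (subsetP LS).
rewrite cardsU1 iL exprS !mulN1r mulNr.
congr (_ * D _ - _ * D _); apply/rowP => j; rewrite !mxE !in_setU1.
all: have [->|//] := eqVneq j i; by rewrite (negbTE iL) ?(negbTE iS).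
Qed.

Lemma reflectionE p D u :
  reflection p D u =
  \sum_(L : {set 'I_n} | L \subset min_vars n p)
    (-1) ^+ #|L| * D (flip_vertex (min_vars n p) L u).
Proof.
rewrite /reflection foldr_flipE ?enum_uniq //.
suff -> : [set:: enum (min_vars n p)] = min_vars n p by [].
by apply/setP => i; rewrite inE mem_enum.
Qed.

(** A flip in a variable at [0] is a difference of two equal values. *)
Lemma reflection_eq0 p D u (i : 'I_n) : (p <= i)%N -> u 0 i = 0 -> reflection p D u = 0.
Proof.
move=> pi; have : i \in enum (min_vars n p) by rewrite mem_enum inE.
rewrite /reflection; elim: (enum _) u => // j s IH u.
rewrite inE /= /flip; have [<- _ ui0|ij /= si ui0] := eqVneq i j.
  by rewrite ui0 subr0 subrr.
by rewrite !IH ?subrr // mxE (negbTE ij).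
Qed.

End Reflection.

(** * Generators *)

Section GeneratorBounds.
Variables (R : realType) (phi : R -> R).

Lemma upper_star_le1 x : F1 phi -> 0 < x <= 1 -> upper_star phi x <= 1.
Proof.
case=> -[_ _ _ phi1] _ H /andP[x0 x1].
have -> : 1 = upper_star phi 1 by rewrite /upper_star phi1 divr1.
by apply: H => //; rewrite in_itv /= ?ltr01 ?lexx ?x0 ?x1.
Qed.

Lemma lower_star_ge0 x : F2 phi -> 0 <= x <= 1 -> 0 <= lower_star phi x.
Proof.
case=> -[_ _ phi0 _] _ H /andP[x0 x1].
have -> : 0 = lower_star phi 0.
  by rewrite /lower_star eq_sym oner_eq0 phi0 subrr mul0r.
by apply: H => //; rewrite in_itv /= ?ler01 ?lexx ?x0 ?x1.
Qed.

Lemma F1_gt0 x : F1 phi -> 0 < x <= 1 -> 0 < phi x.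
Proof.
case=> -[phi01 _ _ _] phiN0 _ /andP[x0 x1].
rewrite lt_neqAle eq_sym phiN0 ?in_itv /= ?x0 //.
by have := phi01 x; rewrite !in_itv /= (ltW x0) x1 => /(_ isT)/andP[].
Qed.

Lemma F2_lt1 x : F2 phi -> 0 <= x < 1 -> phi x < 1.
Proof.
case=> -[phi01 _ _ _] phiN1 _ /andP[x0 x1].
rewrite lt_neqAle phiN1 ?in_itv /= ?x0 //.
by have := phi01 x; rewrite !in_itv /= (ltW x1) x0 => /(_ isT)/andP[].
Qed.

End GeneratorBounds.

(** * The reflected maxmin copula *)

Section MaxminVertex.
Variables (R : realType) (n p : nat) (C : 'rV[R]_n -> R) (phi : 'I_n -> R -> R).
Hypotheses (hp : (0 < p)%N) (hpn : (p < n)%N).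
Hypothesis hF1 : forall i : 'I_n, (i < p)%N -> F1 (phi i).
Hypothesis hF2 : forall i : 'I_n, (p <= i)%N -> F2 (phi i).
Variable u : 'rV[R]_n.
Hypotheses (hu : in_cube u) (u_neq0 : forall i, u 0 i != 0).

Let S := min_vars n p.
Let a i := gen_star p phi i (u 0 i).
Let b i := gen_star p phi i (1 - u 0 i).
Let A := finmin (fun i => i \in ~: S) a.

Let inS i : (i \in S) = (p <= i)%N. Proof. by rewrite inE. Qed.

Let u_itv i : 0 < u 0 i <= 1.
Proof.
by have := hu i; rewrite in_itv /= => /andP[u0 ->]; rewrite lt_neqAle eq_sym u_neq0 u0.
Qed.

Let max0 : exists i0, i0 \in ~: S.
Proof. by exists (Ordinal (ltn_trans hp hpn)); rewrite inE inS -ltnNge. Qed.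

Let A_le1 : A <= 1.
Proof.
have [i0 i0S] := max0.
apply: le_trans (_ : a i0 <= 1); first exact: (finmin_geP _ _ i0S).
move: i0S; rewrite inE inS -ltnNge => i0p; rewrite /a /gen_star i0p.
by apply: upper_star_le1; [apply: hF1|].
Qed.

Let b_ge0 i : i \in S -> 0 <= b i.
Proof.
rewrite inS => pi; rewrite /b /gen_star ltnNge pi.
by apply: lower_star_ge0; [apply: hF2|have := u_itv i; lra].
Qed.

Let star1 i : i \in S -> gen_star p phi i 1 = 1.
Proof. by rewrite inS => pi; rewrite /gen_star ltnNge pi /= /lower_star eqxx. Qed.

Let phi1 i : i \in S -> phi i 1 = 1.
Proof. by rewrite inS => /hF2[[]]. Qed.

(** The minima outside [L] sit at [1], where their starred generator takes the
    value [1], the largest possible.  Such an index kills the term if it lies in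
    [M], and otherwise influences neither the minimum nor the value of [C]. *)
Lemma maxmin_vertex (L : {set 'I_n}) : L \subset S ->
  maxmin p phi C (flip_vertex S L u) =
  \sum_(M : {set 'I_n} | M \subset L)
    C (\row_i (if i \in M then phi i (1 - u 0 i) else
               if i \in S then 1 else phi i (u 0 i))) *
    Num.max 0 (\big[Num.min/A]_(i in L :\: M) b i - \big[Num.max/0]_(i in M) b i).
Proof.
move=> LS; rewrite /maxmin -/S ifF; last first.
  apply/negbTE/existsPn => i; apply/negP => /andP[ip]; rewrite mxE.
  have iS : i \notin S by rewrite inS -ltnNge.
  by rewrite !ifN ?(negbTE (u_neq0 i)) //; apply: contra iS; apply: (subsetP LS).
have starL i : i \in L -> gen_star p phi i (flip_vertex S L u 0 i) = b i.
  by move=> iL; rewrite mxE iL.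
have starS i : i \in S -> i \notin L -> gen_star p phi i (flip_vertex S L u 0 i) = 1.
  by move=> iS iL; rewrite mxE (negbTE iL) iS star1.
have starC i : i \notin S -> gen_star p phi i (flip_vertex S L u 0 i) = a i.
  by move=> iS; rewrite mxE !ifN //; apply: contra iS; apply: (subsetP LS).
have starC' i : i \in ~: S -> gen_star p phi i (flip_vertex S L u 0 i) = a i.
  by rewrite inE; apply: starC.
have [i0 i0S] := max0.
(* From here on a term is indexed by the set [M] of minima that enter the
   maximum, rather than by its complement [K]. *)
rewrite (reindex_onto (fun M => S :\: M) (fun K => S :\: K)) /=; last first.
  by move=> K KS; rewrite setDDr setDv set0U; apply/setIidPr.
rewrite (eq_bigl (fun M : {set 'I_n} => M \subset S)); last first.
  by move=> M; rewrite subsetDl setDDr setDv set0U; apply/eqP/idP => /setIidPr.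
rewrite [RHS](eq_bigl (fun M : {set 'I_n} => (M \subset S) && (M \subset L))); last first.
  move=> M; have [ML|_] := boolP (M \subset L); last by rewrite andbF.
  by rewrite (subset_trans ML LS).
rewrite [RHS]big_mkcondr /=; apply: eq_bigr => M MS.
have -> : S :\: (S :\: M) = M by rewrite setDDr setDv set0U; apply/setIidPr.
have i0U : i0 \in ~: S :|: S :\: M by rewrite inE i0S.
case: ifPn => [ML|/subsetPn[i iM iL]]; last first.
  have iS : i \in S by apply: (subsetP MS).
  rewrite (_ : Num.max 0 _ = 0) ?mulr0 //; apply/max_idPl; rewrite subr_le0.
  (* An index [i] of [M] outside [L] makes the maximum at least [1]. *)
  apply: (@le_trans _ _ 1).
    apply: le_trans A_le1; apply/(finmin_geP _ _ i0S) => j jS; rewrite -starC' //.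
    by apply: (finmin_geP _ _ i0U (lexx _)); apply/setUP; left.
  by rewrite -(starS i iS iL); apply: (finmax_leP _ _ iM (lexx _)).
congr (C _ * Num.max 0 (_ - _)).
- apply/rowP => i; rewrite !mxE in_setD.
  have [iM|iM] := boolP (i \in M); first by rewrite (subsetP ML).
  have [//|iS] := boolP (i \in S).
  by rewrite ifN //; apply: contra iS; apply: (subsetP LS).
- apply/eqP; rewrite eq_sym -eqr_opp; apply/eq_leP => y.
  rewrite lerNl [RHS]lerNl.
  apply/bigmin_geP/(finmin_geP _ _ i0U) => [[yA yb] i|yF].
    have [iS|iS _] := boolP (i \in S); last first.
      have iC : i \in ~: S by rewrite inE.
      by rewrite starC //; apply: (finmin_geP _ _ i0S yA _ iC).
    move=> /setUP[/setCP//|/setDP[_ iM]].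
    have [iL|iL] := boolP (i \in L); last by rewrite starS // (le_trans yA).
    by rewrite starL // yb // inE iL iM.
  split=> [|i].
    by apply/(finmin_geP _ _ i0S) => i iS; rewrite -starC' // yF //; apply/setUP; left.
  rewrite in_setD => /andP[iM iL]; rewrite -starL // yF //.
  by apply/setUP; right; rewrite in_setD iM (subsetP LS).
rewrite finmax_ge0E => [|i iM]; last by rewrite starL ?(subsetP ML) // b_ge0 ?(subsetP MS).
by apply: eq_bigr => i iM; rewrite starL // (subsetP ML).
Qed.

(** For fixed [M] the sum over the vertices [L] containing it is an
    inclusion-exclusion whose value does not depend on [M]. *)
Lemma reflected_maxminE :
  reflected_maxmin p phi C u =
  reflection p C (\row_i refl_gen_hat p phi i (u 0 i)) *
  Num.max 0 (A - finmax (fun i => i \in S) b).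
Proof.
rewrite /reflected_maxmin !reflectionE -/S.
under eq_bigr => L LS do rewrite maxmin_vertex // mulr_sumr.
rewrite exchange_subsets mulr_suml; apply: eq_bigr => M MS.
pose c := C (\row_i (if i \in M then phi i (1 - u 0 i) else
                     if i \in S then 1 else phi i (u 0 i))).
have -> : flip_vertex S M (\row_i refl_gen_hat p phi i (u 0 i)) =
    \row_i (if i \in M then phi i (1 - u 0 i) else
            if i \in S then 1 else phi i (u 0 i)).
  apply/rowP => i; rewrite !mxE /refl_gen_hat /refl_gen.
  case: ifP => [iM|_]; last case: ifP => // /negbT.
    have := subsetP MS i iM; rewrite inS leqNgt => /negbTE ->; ring.
  by rewrite inS -ltnNge => ->; ring.
rewrite -/c finmax_ge0E; last by move=> i; apply: b_ge0.
rewrite -mulrA.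
under eq_bigr => N.
  rewrite subsetD => /andP[NS NM].
  have -> : (M :|: N) :\: M = N by rewrite setDUl setDv set0U; apply/setDidPl.
  have -> : #|M :|: N| = (#|M| + #|N|)%N.
    by rewrite cardsU setIC disjoint_setI0 // cards0 subn0.
  rewrite exprD -mulrA [X in _ * X]mulrCA -/c.
  over.
rewrite /= -!mulr_sumr sum_alternating_hinge; congr (_ * (_ * Num.max 0 (A - _))).
apply/eqP/eq_leP => y; apply/bigmax_leP/bigmax_leP.
  move=> [/bigmax_leP[y0 yM] yN]; split=> // i iS.
  have [/yM//|iM] := boolP (i \in M); by apply: yN; rewrite in_setD iM.
move=> [y0 yS]; split; last by move=> i; rewrite in_setD => /andP[_ /yS].
by apply/bigmax_leP; split=> // i /(subsetP MS)/yS.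
Qed.

Lemma refl_gen_hat_gt0 i : 0 < refl_gen_hat p phi i (u 0 i).
Proof.
have /andP[u0 u1] := u_itv i; rewrite /refl_gen_hat /refl_gen.
case: ltnP => [/hF1|/hF2] F.
  have := F1_gt0 F (u_itv i); lra.
have : 0 <= 1 - u 0 i < 1 by lra.
by move=> /(F2_lt1 F); lra.
Qed.

(** Up to the factors [fhat], the numbers of the formula are the differences of
    starred generators, because [a j = u_j / fhat_j] and
    [b k = 1 - u_k / fhat_k]. *)
Lemma refl_gen_pairE (j k : 'I_n) : (j < p)%N -> (p <= k)%N ->
  (u 0 j * u 0 k - refl_gen p phi j (u 0 j) * refl_gen p phi k (u 0 k)) *
    \prod_(i < n | (i != j) && (i != k)) refl_gen_hat p phi i (u 0 i) =
  (a j - b k) * \prod_(i < n) refl_gen_hat p phi i (u 0 i).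
Proof.
move=> jp pk; have jk : k != j by apply/eqP => kj; rewrite kj leqNgt jp in pk.
rewrite [in RHS](bigD1 j) //= [in RHS](bigD1 k) //= !mulrA; congr (_ * _).
have := refl_gen_hat_gt0 j; have := refl_gen_hat_gt0 k.
have u1 : 1 - u 0 k != 1 by have := u_neq0 k; apply: contra => /eqP ?; apply/eqP; lra.
rewrite /a /b /gen_star /refl_gen_hat /refl_gen jp ltnNge pk /=.
rewrite /upper_star /lower_star (negbTE u1) => k0 j0.
field; apply/andP; split; apply: lt0r_neq0; lra.
Qed.

End MaxminVertex.

Theorem theorem14 (R : realType) (n p : nat) (hp : (1 <= p)%N) (hpn : (p < n)%N)
    (C : 'rV[R]_n -> R) (hC : copula C)
    (phi : 'I_n -> R -> R)
    (hF1 : forall i : 'I_n, (i < p)%N -> F1 (phi i))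
    (hF2 : forall i : 'I_n, (p <= i)%N -> F2 (phi i))
    (u : 'rV[R]_n) (hu : in_cube u) :
  let f := refl_gen p phi in
  let fhat := refl_gen_hat p phi in
  reflected_maxmin p phi C u =
  if [exists i : 'I_n, u 0 i == 0] then 0 else
    reflection p C (\row_i fhat i (u 0 i)) / (\prod_(i < n) fhat i (u 0 i)) *
    Num.max 0
      (finmin (fun jk : 'I_n * 'I_n => (jk.1 < p)%N && (p <= jk.2)%N)
        (fun jk : 'I_n * 'I_n =>
           let: (j, k) := jk in
           (u 0 j * u 0 k - f j (u 0 j) * f k (u 0 k)) *
           \prod_(i < n | (i != j) && (i != k)) fhat i (u 0 i))).
Proof.
move=> f fhat; case: ifPn => [/existsP[i /eqP ui0]|/existsPn u_neq0].
  have [pi|ip] := leqP p i; first exact: reflection_eq0 ui0.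
  rewrite /reflected_maxmin reflectionE big1 // => L /subsetP LS.
  rewrite /maxmin ifT ?mulr0 //; apply/existsP; exists i; rewrite ip mxE.
  have iS : i \notin min_vars n p by rewrite inE -ltnNge.
  have iL : i \notin L by apply: contra iS => /LS.
  by rewrite (negbTE iL) (negbTE iS) ui0 eqxx.
rewrite reflected_maxminE //.
have prod_gt0 : 0 < \prod_(i < n) fhat i (u 0 i).
  by apply: prodr_gt0 => i _; apply: refl_gen_hat_gt0.
pose S := min_vars n p.
rewrite [in RHS](@eq_finmin _ _ _ (fun jk => (jk.1 \in ~: S) && (jk.2 \in S)) _
    (fun jk => (gen_star p phi jk.1 (u 0 jk.1) - gen_star p phi jk.2 (1 - u 0 jk.2)) *
               \prod_(i < n) fhat i (u 0 i))); first last.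
- by move=> [j k] /andP[jp pk]; apply: refl_gen_pairE.
- by move=> [j k]; rewrite !inE -ltnNge.
have n0 : Ordinal (ltn_trans hp hpn) \in ~: S by rewrite !inE -ltnNge.
have np : Ordinal hpn \in S by rewrite inE.
rewrite (@finmin_pair _ _ _ (fun j => j \in ~: S) (fun k => k \in S)
  (fun j => gen_star p phi j (u 0 j)) (fun k => gen_star p phi k (1 - u 0 k))
  _ _ _ n0 np) //.
rewrite -[X in Num.max X (_ * _)](mul0r (\prod_(i < n) fhat i (u 0 i))).
rewrite -maxr_pMl ?(ltW prod_gt0) //.
by rewrite [X in _ / _ * X]mulrC mulrA divfK ?gt_eqF.
Qed.
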